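(* If $(F_\bullet A,F_\bullet D)$ is a filtered $C_2$-equivariant formal group law, then for every $n\ge0$ $$F_nA=F_nMU^{C_2}_*\cdot F_0A\qquad\text{and}\qquad F_nD=F_nMU^{C_2}_*\cdot F_0D.$$
   Context: $C_2^\vee=\{1,\sigma\}$ is the character group of $C_2$. For a commutative ring $A$, an $A$-Hopf algebra is a group object in coassociative, cocommutative, counital $A$-coalgebras. For an $A$-linear functional $x$ on such a $D$, $\langle d,x\rangle$ is its value at $d$, and $\cap x$ is the composite $D\xrightarrow{\Delta}D\otimes D\xrightarrow{1\otimes x}D$. Given an $A$-Hopf algebra map $A[C_2^\vee]\to D$, put $\langle d,x^\sigma\rangle=\langle\sigma d,x\rangle$ and $\langle d,x^{m+n\sigma}\rangle=\langle\Delta d,x^{\otimes m}\otimes(x^\sigma)^{\otimes n}\rangle$ ($\Delta$ iterated). A $C_2$-equivariant formal group law $(A,D)$ consists of a commutative ring $A$, an $A$-Hopf algebra $D$, an $A$-Hopf algebra map $A[C_2^\vee]\to D$ and an $A$-linear functional $x$ on $D$ such that (1) $0\to A\xrightarrow{\eta}D\xrightarrow{\cap x}D\to0$ is exact ($\eta$ the unit), and (2) each $d\in D$ satisfies $d\cap x^{m+n\sigma}=0$ for some $m,n\ge0$. $MU_{C_2}$ is the stable (tom Dieck) $C_2$-equivariant complex cobordism spectrum and $\mathbf{CP}^\infty_{C_2}=\mathbf{CP}(U)$, with $U=\mathbf C^\infty\oplus(\mathbf C^\sigma)^\infty$. The pair $(MU^{C_2}_*,MU^{C_2}_*(\mathbf{CP}^\infty_{C_2}))$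 is the universal $C_2$-equivariant formal group law, so every $(A,D)$ receives a canonical map from it; elements of $MU^{C_2}_*$ and of $MU^{C_2}_*(\mathbf{CP}^\infty_{C_2})$ are regarded as elements of $A$, $D$ via this map. In particular there are $u\in A$, the image of the Euler class $u\in MU^{C_2}_{-2}$ of $\mathbf C^\sigma$, and $\Pi_{m+n\sigma}\in D$, the image of $[\mathbf{CP}(\mathbf C^m\oplus(\mathbf C^\sigma)^n)\to\mathbf{CP}^\infty_{C_2}]$. $\Omega^{C_2}_*$ is the cobordism ring of stably almost complex $C_2$-manifolds, mapping to $MU^{C_2}_*$ by the Pontrjagin–Thom construction. $F_nMU^{C_2}_*$ is the $\Omega^{C_2}_*$-submodule of $MU^{C_2}_*$ generated by $1,u,\dots,u^n$. A complete flag is a sequence $(\rho_i)_{i=1}^\infty$ in $\{1,\sigma\}$ in which each of $1,\sigma$ occurs infinitely often. For any complete flag, $\{\Pi_{\rho_1+\cdots+\rho_i}:i\ge1\}$ is a free $A$-module basis of $D$. A filtered $C_2$-equivariant formal group law $(F_\bullet A,F_\bullet D)$ consists of a $C_2$-equivariant formal group law $(A,D)$ and increasing filtrations $F_0A\subseteq F_1A\subseteq\cdots\subseteq A$ and $F_0D\subseteq F_1D\subseteq\cdots\subseteq D$ such that: (1) $\mathrm{Im}(\Omega^{C_2}_*\to A)\subseteq F_0A$; (2) $F_nA$ is generated over $F_0A$ by $1,u,\dots,u^n$; (3) for any complete flag $(\rho_i)$, $F_nD=\{\sum a_i\Pi_{\rho_1+\cdots+\rho_i}\in D: a_i\in F_{n+\ell_i}A\}$,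 where $\ell_i$ is the number of copies of $\sigma$ in $(\rho_1+\cdots+\rho_{i-1})\rho_i^{-1}$ (i.e. the number of $j<i$ with $\rho_j\ne\rho_i$). A product such as $F_nMU^{C_2}_*\cdot F_0D$ denotes the additive subgroup generated by all products. *)

(* Defs.v *)
From HB Require Import structures.
From mathcomp Require Import all_fingroup.
From mathcomp Require Import all_boot all_order all_algebra.
From mathcomp Require Import boolp classical_sets.

Set Implicit Arguments.
Unset Strict Implicit.
Unset Printing Implicit Defensive.

Import GRing.Theory.

Local Open Scope classical_set_scope.
Local Open Scope ring_scope.

Declare Scope efgl_scope.
Delimit Scope efgl_scope with efgl.
Local Open Scope efgl_scope.

(* Tensor product of modules over a commutative ring: formal sums of pairs,   *)
(* represented by sequences, modulo the usual relations.                      *)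

Section Tensor.
Variables (A : comPzRingType) (D E : lmodType A).
Implicit Types (s t : seq (D * E)).

Inductive tensor_rel : seq (D * E) -> seq (D * E) -> Prop :=
| TensorRefl s : tensor_rel s s
| TensorSym s t : tensor_rel s t -> tensor_rel t s
| TensorTrans s t r : tensor_rel s t -> tensor_rel t r -> tensor_rel s r
| TensorCat s s' t t' :
    tensor_rel s s' -> tensor_rel t t' -> tensor_rel (s ++ t) (s' ++ t')
| TensorCatC s t : tensor_rel (s ++ t) (t ++ s)
| TensorZero e : tensor_rel [:: (0, e)] [::]
| TensorAddl d d' e : tensor_rel [:: (d + d', e)] [:: (d, e); (d', e)]
| TensorAddr d e e' : tensor_rel [:: (d, e + e')] [:: (d, e); (d, e')]
| TensorScale a d e : tensor_rel [:: (a *: d, e)] [:: (d, a *: e)].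

Definition tensor_eqb s t := `[< tensor_rel s t >].

Lemma tensor_eqb_refl : reflexive tensor_eqb.
Proof. by move=> s; apply/asboolP; exact: TensorRefl. Qed.

Lemma tensor_eqb_sym : symmetric tensor_eqb.
Proof. by move=> s t; apply/asboolP/asboolP; exact: TensorSym. Qed.

Lemma tensor_eqb_trans : transitive tensor_eqb.
Proof.
by move=> t s r /asboolP st /asboolP tr; apply/asboolP; exact: TensorTrans tr.
Qed.

Canonical tensor_equiv :=
  EquivRel tensor_eqb tensor_eqb_refl tensor_eqb_sym tensor_eqb_trans.

Local Open Scope quotient_scope.

Definition tensor := {eq_quot tensor_equiv}.

HB.instance Definition _ := Choice.on tensor.
HB.instance Definition _ := Quotient.on tensor.
HB.instance Definition _ := EqQuotient.on tensor.

Lemma tensorP s t : \pi_tensor s = \pi_tensor t <-> tensor_rel s t.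
Proof.
split=> [/eqmodP /asboolP //|st]; by apply/eqmodP/asboolP.
Qed.

Lemma tensor_repr s : tensor_rel (repr (\pi_tensor s)) s.
Proof. by apply/tensorP; rewrite reprK. Qed.

Definition tens (d : D) (e : E) : tensor := \pi_tensor [:: (d, e)].

Definition tensor_zero : tensor := \pi_tensor [::].
Definition tensor_add (x y : tensor) : tensor := \pi_tensor (repr x ++ repr y).
Definition tensor_scale (a : A) (x : tensor) : tensor :=
  \pi_tensor [seq (a *: p.1, p.2) | p <- repr x].
Definition tensor_opp (x : tensor) : tensor :=
  \pi_tensor [seq (- p.1, p.2) | p <- repr x].

Lemma tensor_add_pi s t :
  tensor_add (\pi_tensor s) (\pi_tensor t) = \pi_tensor (s ++ t).
Proof. by apply/tensorP; apply: TensorCat; exact: tensor_repr. Qed.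

Lemma tensor_map_rel (f : D -> D) s t :
  {morph f : x y / x + y} -> f 0 = 0 -> scalable f ->
  tensor_rel s t ->
  tensor_rel [seq (f p.1, p.2) | p <- s] [seq (f p.1, p.2) | p <- t].
Proof.
move=> fD f0 fZ; elim=> {s t}.
- by move=> s; exact: TensorRefl.
- by move=> s t _; exact: TensorSym.
- by move=> s t r _ st _; exact: TensorTrans.
- by move=> s s' t t' _ ss' _ tt'; rewrite !map_cat; exact: TensorCat.
- by move=> s t; rewrite !map_cat; exact: TensorCatC.
- by move=> e /=; rewrite f0; exact: TensorZero.
- by move=> d d' e /=; rewrite fD; exact: TensorAddl.
- by move=> d e e' /=; exact: TensorAddr.
- by move=> a d e /=; rewrite fZ; exact: TensorScale.
Qed.

Lemma tensor_scale_pi a s :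
  tensor_scale a (\pi_tensor s) = \pi_tensor [seq (a *: p.1, p.2) | p <- s].
Proof.
apply/tensorP; apply: (@tensor_map_rel (fun d => a *: d)).
- by move=> x y; rewrite scalerDr.
- exact: scaler0.
- by move=> b d; rewrite !scalerA mulrC.
- exact: tensor_repr.
Qed.

Lemma tensor_opp_pi s :
  tensor_opp (\pi_tensor s) = \pi_tensor [seq (- p.1, p.2) | p <- s].
Proof.
apply/tensorP; apply: (@tensor_map_rel (fun d => - d)).
- by move=> x y; rewrite opprD.
- exact: oppr0.
- by move=> b d; rewrite scalerN.
- exact: tensor_repr.
Qed.

Lemma tensor_addA : associative tensor_add.
Proof.
elim/(@quotW _ tensor)=> s; elim/(@quotW _ tensor)=> t; elim/(@quotW _ tensor)=> r.
by rewrite !tensor_add_pi catA.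
Qed.

Lemma tensor_addC : commutative tensor_add.
Proof.
elim/(@quotW _ tensor)=> s; elim/(@quotW _ tensor)=> t; rewrite !tensor_add_pi.
by apply/tensorP; exact: TensorCatC.
Qed.

Lemma tensor_add0 : left_id tensor_zero tensor_add.
Proof. by elim/(@quotW _ tensor)=> s; rewrite tensor_add_pi. Qed.

Lemma tensor_zipD (f g h : D -> D) s :
  (forall d, h d = f d + g d) ->
  tensor_rel [seq (h p.1, p.2) | p <- s]
    ([seq (f p.1, p.2) | p <- s] ++ [seq (g p.1, p.2) | p <- s]).
Proof.
move=> hE; elim: s => [|[d e] s IHs] /=; first exact: TensorRefl.
rewrite hE; set s1 := map (fun p => (f p.1, _)) s; set s2 := map (fun p => (g p.1, _)) s.
apply: (@TensorTrans _ ([:: (f d, e); (g d, e)] ++ (s1 ++ s2))).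
  exact: TensorCat (TensorAddl (f d) (g d) e) IHs.
apply: (@TensorCat [:: (f d, e)] [:: (f d, e)] ([:: (g d, e)] ++ (s1 ++ s2))
                   (s1 ++ ([:: (g d, e)] ++ s2))); first exact: TensorRefl.
by rewrite !catA; apply: TensorCat; [exact: TensorCatC | exact: TensorRefl].
Qed.

Lemma tensor_map0 s : tensor_rel [seq (0 : D, p.2) | p <- s] [::].
Proof.
elim: s => [|[d e] s IHs] /=; first exact: TensorRefl.
rewrite -cat1s -[X in tensor_rel _ X]cat0s.
by apply: TensorCat => //; exact: TensorZero.
Qed.

Lemma tensor_addN : left_inverse tensor_zero tensor_opp tensor_add.
Proof.
elim/(@quotW _ tensor)=> s; rewrite tensor_opp_pi tensor_add_pi; apply/tensorP.
have := @tensor_zipD (fun d => - d) id (fun=> 0) s.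
rewrite (_ : [seq (id p.1, p.2) | p <- s] = s); last first.
  by rewrite -[RHS]map_id; apply: eq_map => -[].
move=> /(_ (fun d => esym (addNr d))) H.
exact: TensorTrans (TensorSym H) (tensor_map0 _).
Qed.

HB.instance Definition _ := GRing.isZmodule.Build tensor
  tensor_addA tensor_addC tensor_add0 tensor_addN.

Lemma tensor_scaleA a b x :
  tensor_scale a (tensor_scale b x) = tensor_scale (a * b) x.
Proof.
elim/(@quotW _ tensor): x => s; rewrite !tensor_scale_pi -map_comp.
by congr (\pi_tensor _); apply: eq_map => p /=; rewrite scalerA.
Qed.

Lemma tensor_scale1 : left_id 1 tensor_scale.
Proof.
elim/(@quotW _ tensor)=> s; rewrite tensor_scale_pi; congr (\pi_tensor _).
by rewrite -[RHS]map_id; apply: eq_map => -[d e]; rewrite scale1r.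
Qed.

Lemma tensor_scaleDr : right_distributive tensor_scale +%R.
Proof.
move=> a; elim/(@quotW _ tensor)=> s; elim/(@quotW _ tensor)=> t.
by rewrite [_ + _]tensor_add_pi !tensor_scale_pi [RHS]tensor_add_pi map_cat.
Qed.

Lemma tensor_scaleDl x : {morph tensor_scale^~ x : a b / a + b}.
Proof.
move=> a b; elim/(@quotW _ tensor): x => s; rewrite /= !tensor_scale_pi [RHS]tensor_add_pi.
by apply/tensorP; apply: tensor_zipD => d; rewrite scalerDl.
Qed.

HB.instance Definition _ := GRing.Zmodule_isLmodule.Build A tensor
  tensor_scaleA tensor_scale1 tensor_scaleDr tensor_scaleDl.

(* The map out of the tensor product induced by B; it is only meaningful for  *)
(* biadditive, A-balanced B (see tlift_tens).                                 *)
Definition tlift (M : nmodType) (B : D -> E -> M) (t : tensor) : M :=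
  \sum_(p <- repr t) B p.1 p.2.

Definition balanced (M : nmodType) (B : D -> E -> M) : Prop :=
  [/\ forall e, B 0 e = 0,
      forall d d' e, B (d + d') e = B d e + B d' e,
      forall d e e', B d (e + e') = B d e + B d e' &
      forall a d e, B (a *: d) e = B d (a *: e)].

Lemma tlift_pi (M : nmodType) (B : D -> E -> M) s :
  balanced B -> tlift B (\pi_tensor s) = \sum_(p <- s) B p.1 p.2.
Proof.
move=> [B0 BDl BDr BZ]; rewrite /tlift.
move: (tensor_repr s); move: (repr _) => r; elim=> {r s} //.
- by move=> ? ? ? _ -> _ ->.
- by move=> ? ? ? ? _ IH _ IH'; rewrite !big_cat /= IH IH'.
- by move=> ? ?; rewrite !big_cat /= addrC.
- by move=> e; rewrite big_seq1 big_nil B0.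
- by move=> ? ? ?; rewrite !big_cons !big_nil /= !addr0 BDl.
- by move=> ? ? ?; rewrite !big_cons !big_nil /= !addr0 BDr.
- by move=> ? ? ?; rewrite !big_seq1 BZ.
Qed.

Lemma tlift_tens (M : nmodType) (B : D -> E -> M) d e :
  balanced B -> tlift B (tens d e) = B d e.
Proof. by move=> Bb; rewrite /tens tlift_pi // big_seq1. Qed.

Lemma tliftD (M : nmodType) (B : D -> E -> M) :
  balanced B -> {morph tlift B : x y / x + y}.
Proof.
move=> Bb; elim/(@quotW _ tensor)=> s; elim/(@quotW _ tensor)=> t; rewrite [X in tlift _ X]tensor_add_pi.
by rewrite !tlift_pi // big_cat.
Qed.

Lemma tlift0 (M : nmodType) (B : D -> E -> M) : balanced B -> tlift B 0 = 0.
Proof. by move=> Bb; rewrite tlift_pi // big_nil. Qed.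

Lemma tens_balanced : balanced tens.
Proof.
split=> [e|d d' e|d e e'|a d e]; rewrite /tens.
- by apply/tensorP; exact: TensorZero.
- by rewrite [RHS]tensor_add_pi; apply/tensorP; exact: TensorAddl.
- by rewrite [RHS]tensor_add_pi; apply/tensorP; exact: TensorAddr.
- by apply/tensorP; exact: TensorScale.
Qed.

Lemma tensZl a d e : tens (a *: d) e = a *: tens d e.
Proof. by rewrite [RHS]tensor_scale_pi. Qed.

Lemma tens_ind (P : tensor -> Prop) :
  P 0 -> (forall x y, P x -> P y -> P (x + y)) ->
  (forall d e, P (tens d e)) -> forall x, P x.
Proof.
move=> P0 PD Pt; apply: quotW; elim=> [|[d e] s IHs] //.
by have := PD _ _ (Pt d e) IHs; rewrite [X in P X]tensor_add_pi.
Qed.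

End Tensor.

Notation "d ⊗ e" := (tens d e)
  (at level 40, left associativity, format "d  ⊗  e") : efgl_scope.

(* The maps f ⊗ g may be semilinear, hence the two base rings.                *)
Definition tmap (A B : comPzRingType) (D E : lmodType A) (D' E' : lmodType B)
    (f : D -> D') (g : E -> E') : tensor D E -> tensor D' E' :=
  tlift (fun d e => f d ⊗ g e).

Definition tswap (A : comPzRingType) (D E : lmodType A) :
    tensor D E -> tensor E D :=
  tlift (fun d e => e ⊗ d).

Definition tassoc (A : comPzRingType) (D E F : lmodType A) :
    tensor (tensor D E) F -> tensor D (tensor E F) :=
  tlift (fun t f => tlift (fun d e => d ⊗ (e ⊗ f)) t).

Section TensorMaps.
Variable A : comPzRingType.

Lemma linear_comp (U W M : lmodType A) (f : W -> M) (g : U -> W) :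
  linear f -> linear g -> linear (fun u => f (g u)).
Proof. by move=> fl gl a u v; rewrite gl fl. Qed.

Lemma linear_parts (U W : lmodType A) (f : U -> W) : linear f ->
  [/\ f 0 = 0, {morph f : x y / x + y} & forall a x, f (a *: x) = a *: f x].
Proof.
move=> fl.
have f0 : f 0 = 0.
  by have := fl (-1) 0 0; rewrite scaler0 addr0 scaleN1r addNr.
split=> // [x y|a x]; first by rewrite -[x]scale1r fl !scale1r.
by rewrite -[a *: x]addr0 fl f0 addr0.
Qed.

Lemma tlift_linear (D E M : lmodType A) (B : D -> E -> M) :
  balanced B -> (forall a d e, B (a *: d) e = a *: B d e) -> linear (tlift B).
Proof.
move=> Bb BZ a x y; rewrite tliftD //; congr (_ + _).
elim/tens_ind: x => [|x x' IH IH'|d e].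
- by rewrite scaler0 !tlift0 // scaler0.
- by rewrite scalerDr !tliftD // IH IH' scalerDr.
- by rewrite -tensZl !tlift_tens // BZ.
Qed.

Lemma tensZr (D E : lmodType A) a (d : D) (e : E) : d ⊗ (a *: e) = a *: (d ⊗ e).
Proof.
by case: (tens_balanced D E) => _ _ _ H; rewrite -H tensZl.
Qed.

Lemma tmap_balanced (D E D' E' : lmodType A) (f : D -> D') (g : E -> E') :
  linear f -> linear g -> balanced (fun d e => f d ⊗ g e).
Proof.
move=> /linear_parts[f0 fD fZ] /linear_parts[g0 gD gZ].
case: (tens_balanced D' E') => t0 tl tr tz.
by split=> *; rewrite ?f0 ?fD ?gD ?fZ ?gZ.
Qed.

Lemma tmap_linear (D E D' E' : lmodType A) (f : D -> D') (g : E -> E') :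
  linear f -> linear g -> linear (tmap f g).
Proof.
move=> fl gl; apply: tlift_linear; first exact: tmap_balanced.
by case/linear_parts: fl => _ _ fZ a d e; rewrite fZ tensZl.
Qed.

Lemma tmap_tens (D E D' E' : lmodType A) (f : D -> D') (g : E -> E') d e :
  linear f -> linear g -> tmap f g (d ⊗ e) = f d ⊗ g e.
Proof. by move=> fl gl; rewrite /tmap tlift_tens //; exact: tmap_balanced. Qed.

Lemma id_linear (U : lmodType A) : linear (id : U -> U).
Proof. by []. Qed.

Lemma tswap_balanced (D E : lmodType A) :
  balanced (fun (d : D) (e : E) => e ⊗ d).
Proof.
case: (tens_balanced E D) => t0 tl tr tz.
split=> [e|d d' e|d e e'|a d e].
- by rewrite -(scale0r (0 : D)) tensZr scale0r.
- by rewrite tr.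
- by rewrite tl.
- by rewrite tensZr tensZl.
Qed.

Lemma tassoc_in_balanced (D E F : lmodType A) (f : F) :
  balanced (fun (d : D) (e : E) => d ⊗ (e ⊗ f)).
Proof.
case: (tens_balanced D (tensor E F)) => t0 tl tr tz.
case: (tens_balanced E F) => t0' tl' tr' tz'.
by split=> // *; rewrite ?tl' ?tr' ?tr // tensZl tensZl tensZr.
Qed.

Lemma tassoc_balanced (D E F : lmodType A) :
  balanced (fun (t : tensor D E) (f : F) =>
    tlift (fun (d : D) (e : E) => d ⊗ (e ⊗ f)) t).
Proof.
have H := @tassoc_in_balanced D E F.
split=> [f|t t' f|t f f'|a t f].
- by rewrite tlift0.
- by rewrite tliftD.
- elim/tens_ind: t => [|x y IH IH'|d e].
  + by rewrite !tlift0 // addr0.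
  + by rewrite !tliftD // IH IH' addrACA.
  rewrite !tlift_tens //.
  case: (tens_balanced E F) => _ _ -> _.
  by case: (tens_balanced D (tensor E F)) => _ _ ->.
- elim/tens_ind: t => [|x y IH IH'|d e].
  + by rewrite scaler0 !tlift0.
  + by rewrite scalerDr !tliftD // IH IH'.
  by rewrite -tensZl !tlift_tens // tensZl !tensZr.
Qed.

Lemma tassoc_linear (D E F : lmodType A) : linear (@tassoc A D E F).
Proof.
apply: tlift_linear; first exact: tassoc_balanced.
move=> a t f; elim/tens_ind: t => [|x y IH IH'|d e].
- by rewrite scaler0 !tlift0 ?scaler0 //; exact: tassoc_in_balanced.
- by rewrite scalerDr !tliftD ?IH ?IH' ?scalerDr //; exact: tassoc_in_balanced.
by rewrite -tensZl !tlift_tens ?tensZl //; exact: tassoc_in_balanced.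
Qed.

Lemma tassoc_tens (D E F : lmodType A) (d : D) (e : E) (f : F) :
  tassoc ((d ⊗ e) ⊗ f) = d ⊗ (e ⊗ f).
Proof.
rewrite /tassoc tlift_tens; last exact: tassoc_balanced.
by rewrite tlift_tens //; exact: tassoc_in_balanced.
Qed.

Lemma bilinear_balanced (D E M : lmodType A) (B : D -> E -> M) :
  (forall e, linear (B^~ e)) -> (forall d, linear (B d)) -> balanced B.
Proof.
move=> Bl Br; split=> [e|d d' e|d e e'|a d e].
- by case: (linear_parts (Bl e)).
- by case: (linear_parts (Bl e)) => _ ->.
- by case: (linear_parts (Br d)) => _ ->.
by case: (linear_parts (Bl e)) (linear_parts (Br d)) => _ _ -> [_ _ ->].
Qed.

Lemma tlift_linear_fun (U D E M : lmodType A) (B : U -> D -> E -> M) t :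
  (forall d e, linear (fun u => B u d e)) -> linear (fun u => tlift (B u) t).
Proof.
move=> Bl a u v; rewrite /tlift scaler_sumr -big_split /=.
by apply: eq_bigr => p _; exact: Bl.
Qed.

Lemma tens_linearl (D E : lmodType A) (e : E) : linear (fun d : D => d ⊗ e).
Proof.
by move=> a u v; case: (tens_balanced D E) => _ -> _ _; rewrite tensZl.
Qed.

Lemma tens_linearr (D E : lmodType A) (d : D) : linear (fun e : E => d ⊗ e).
Proof.
by move=> a u v; case: (tens_balanced D E) => _ _ -> _; rewrite tensZr.
Qed.

End TensorMaps.

Record precoalgebra (A : comPzRingType) := Precoalgebra {
  coalg_carrier :> lmodType A;
  comul : coalg_carrier -> tensor coalg_carrier coalg_carrier;
  counit : coalg_carrier -> A }.

Arguments comul {A C} : rename.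
Arguments counit {A C} : rename.

Section Coalgebra.
Variable A : comPzRingType.

Definition cap (C : precoalgebra A) (x : C -> A) (d : C) : C :=
  tlift (fun d1 d2 => x d2 *: d1) (comul d).

(* ⟨d, conv x y⟩ = ⟨Δ d, x ⊗ y⟩.                                              *)
Definition conv (C : precoalgebra A) (x y : C -> A) (d : C) : A :=
  tlift (fun d1 d2 => x d1 * y d2) (comul d).

Record is_coalgebra (C : precoalgebra A) : Prop := IsCoalgebra {
  comul_linear : linear (@comul A C);
  counit_linear : scalar (@counit A C);
  comulA : forall d : C,
    tassoc (tmap comul id (comul d)) = tmap id comul (comul d);
  comulC : forall d : C, tswap (comul d) = comul d;
  comul1 : forall d : C, cap counit d = d }.

Record is_coalgebra_map (C C' : precoalgebra A) (f : C -> C') : Prop :=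
  IsCoalgebraMap {
  coalgebra_map_linear : linear f;
  coalgebra_map_comul : forall d, comul (f d) = tmap f f (comul d);
  coalgebra_map_counit : forall d, counit (f d) = counit d }.

(* A and C ⊗ C' as coalgebras: the terminal object and the binary product of  *)
(* the category of cocommutative coalgebras.                                  *)
Definition unit_coalgebra : precoalgebra A :=
  {| coalg_carrier := A^o;
     comul := fun a : A^o => a ⊗ (1 : A^o);
     counit := fun a : A^o => a |}.

Definition tensor_coalgebra (C C' : precoalgebra A) : precoalgebra A :=
  {| coalg_carrier := tensor C C';
     comul := tlift (fun (c : C) (c' : C') =>
       tlift (fun c1 c2 => tlift (fun c1' c2' => (c1 ⊗ c1') ⊗ (c2 ⊗ c2'))
         (comul c')) (comul c));
     counit := tlift (fun (c : C) (c' : C') => counit c * counit c') |}.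

Section TensorCoalgebra.
Variables (C C' : precoalgebra A).
Hypotheses (Cl : linear (@comul A C)) (C'l : linear (@comul A C')).

Lemma tensor_comul_in_balanced (c1 c2 : C) :
  balanced (fun c1' c2' : C' => (c1 ⊗ c1') ⊗ (c2 ⊗ c2')).
Proof.
apply: bilinear_balanced => c.
  by apply: (linear_comp (f := fun t => t ⊗ _)); [exact: tens_linearl|exact: tens_linearr].
by apply: (linear_comp (f := fun t => _ ⊗ t)); exact: tens_linearr.
Qed.

Lemma tensor_comul_mid_balanced (c' : C') :
  balanced (fun c1 c2 : C =>
    tlift (fun c1' c2' : C' => (c1 ⊗ c1') ⊗ (c2 ⊗ c2')) (comul c')).
Proof.
apply: bilinear_balanced => c; apply: tlift_linear_fun => d d'.
  by apply: (linear_comp (f := fun t => t ⊗ _)); exact: tens_linearl.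
by apply: (linear_comp (f := fun t => _ ⊗ t)); [exact: tens_linearr|exact: tens_linearl].
Qed.

Lemma tensor_comul_balanced :
  balanced (fun (c : C) (c' : C') =>
    tlift (fun c1 c2 => tlift (fun c1' c2' => (c1 ⊗ c1') ⊗ (c2 ⊗ c2'))
      (comul c')) (comul c)).
Proof.
apply: bilinear_balanced => c.
  apply: (linear_comp (f := tlift _) (g := @comul A C)) => //.
  apply: tlift_linear; first exact: tensor_comul_mid_balanced.
  move=> a d e; case: (linear_parts (tlift_linear_fun (U := C)
    (B := fun d (c1' c2' : C') => (d ⊗ c1') ⊗ (e ⊗ c2')) (comul c) _)) => //.
  move=> d' e'.
  by apply: (linear_comp (f := fun t => t ⊗ _)); exact: tens_linearl.
apply: (@tlift_linear_fun A C' _ _ _ (fun c' c1 c2 => tlift _ (comul c'))).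
move=> d e; apply: (linear_comp (f := tlift _) (g := @comul A C')) => //.
apply: tlift_linear; first exact: tensor_comul_in_balanced.
by move=> a u v; rewrite tensZr tensZl.
Qed.

Lemma tensor_comul_linear : linear (@comul A (tensor_coalgebra C C')).
Proof.
apply: tlift_linear; first exact: tensor_comul_balanced.
move=> a d e; case: tensor_comul_balanced => _ _ _ _.
have : linear (fun c : C => tlift (fun c1 c2 => tlift (fun c1' c2' : C' =>
  (c1 ⊗ c1') ⊗ (c2 ⊗ c2')) (comul e)) (comul c)).
  apply: (linear_comp (f := tlift _) (g := @comul A C)) => //.
  apply: tlift_linear; first exact: tensor_comul_mid_balanced.
  move=> b u v; case: (linear_parts (tlift_linear_fun (U := C)
    (B := fun d (c1' c2' : C') => (d ⊗ c1') ⊗ (v ⊗ c2')) (comul e) _)) => //.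
  move=> d' e'.
  by apply: (linear_comp (f := fun t => t ⊗ _)); exact: tens_linearl.
by case/linear_parts.
Qed.

Lemma tensor_comul_tens (c : C) (c' : C') :
  comul c = c ⊗ c -> comul c' = c' ⊗ c' ->
  comul (c ⊗ c' : tensor_coalgebra C C') = (c ⊗ c') ⊗ (c ⊗ c').
Proof.
move=> Ec Ec'; rewrite /= tlift_tens; last exact: tensor_comul_balanced.
rewrite Ec tlift_tens; last exact: tensor_comul_mid_balanced.
by rewrite Ec' tlift_tens //; exact: tensor_comul_in_balanced.
Qed.

End TensorCoalgebra.

Record hopfAlgebra := HopfAlgebra {
  hopf_coalgebra :> precoalgebra A;
  hopf_mul : tensor hopf_coalgebra hopf_coalgebra -> hopf_coalgebra;
  hopf_unit : A -> hopf_coalgebra;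
  hopf_antipode : hopf_coalgebra -> hopf_coalgebra;
  hopf_is_coalgebra : is_coalgebra hopf_coalgebra;
  hopf_mul_map :
    @is_coalgebra_map (tensor_coalgebra hopf_coalgebra hopf_coalgebra)
      hopf_coalgebra hopf_mul;
  hopf_unit_map : @is_coalgebra_map unit_coalgebra hopf_coalgebra hopf_unit;
  hopf_antipode_map : is_coalgebra_map hopf_antipode;
  hopf_mulA : forall t : tensor (tensor hopf_coalgebra hopf_coalgebra)
                           hopf_coalgebra,
    hopf_mul (tmap hopf_mul id t) = hopf_mul (tmap id hopf_mul (tassoc t));
  hopf_mul1l : forall a d, hopf_mul (hopf_unit a ⊗ d) = a *: d;
  hopf_mul1r : forall d a, hopf_mul (d ⊗ hopf_unit a) = a *: d;
  hopf_mulVl : forall d,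
    hopf_mul (tmap hopf_antipode id (comul d)) = hopf_unit (counit d);
  hopf_mulVr : forall d,
    hopf_mul (tmap id hopf_antipode (comul d)) = hopf_unit (counit d) }.

End Coalgebra.

Arguments hopf_mul {A h} _ : rename.
Arguments hopf_unit {A h} _ : rename.
Arguments hopf_antipode {A h} _ : rename.

(* Hopf algebra maps along a ring map phi; an A-Hopf algebra map is one along *)
(* the identity of A.                                                         *)
Record is_hopf_map (A B : comPzRingType) (phi : {rmorphism A -> B})
    (H : hopfAlgebra A) (K : hopfAlgebra B) (g : H -> K) : Prop := IsHopfMap {
  hopf_map_add : {morph g : d d' / d + d'};
  hopf_map_scale : forall a d, g (a *: d) = phi a *: g d;
  hopf_map_comul : forall d, comul (g d) = tmap g g (comul d);
  hopf_map_counit : forall d, counit (g d) = phi (counit d);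
  hopf_map_mul : forall t, g (hopf_mul t) = hopf_mul (tmap g g t);
  hopf_map_unit : forall a, g (hopf_unit a) = hopf_unit (phi a);
  hopf_map_antipode : forall d, g (hopf_antipode d) = hopf_antipode (g d) }.

Section GroupAlgebra.
Variables (A : comPzRingType) (gT : finGroupType).

Local Notation V := {ffun gT -> A^o}.

Definition ga_basis (g : gT) : V := [ffun h => (h == g)%:R].

Local Notation e_ := ga_basis.

Definition ga_counit (f : V) : A := \sum_g f g.
Definition ga_comul (f : V) : tensor V V := \sum_g (f g : A) *: (e_ g ⊗ e_ g).

Definition ga_coalgebra : precoalgebra A :=
  {| coalg_carrier := V; comul := ga_comul; counit := ga_counit |}.

Definition ga_mul : tensor V V -> V :=
  tlift (fun f f' : V => \sum_g \sum_h (f g * f' h : A) *: e_ (g * h)%g).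
Definition ga_unit (a : A) : V := a *: e_ 1%g.
Definition ga_antipode (f : V) : V := \sum_g (f g : A) *: e_ g^-1%g.

Lemma ga_decomp (f : V) : f = \sum_g (f g : A) *: e_ g.
Proof.
apply/ffunP => h; rewrite sum_ffunE (bigD1 h) //= big1 => [|g gh].
  by rewrite !ffunE eqxx addr0 [RHS]mulr1.
by rewrite !ffunE eq_sym (negPf gh) [LHS]mulr0.
Qed.

Lemma ga_sumE (M : lmodType A) (F : gT -> M) g : \sum_h (e_ g h : A) *: F h = F g.
Proof.
rewrite (bigD1 g) //= big1 => [|h hg]; rewrite ffunE.
  by rewrite eqxx scale1r addr0.
by rewrite (negPf hg) scale0r.
Qed.

Lemma ga_sum_linear (M : lmodType A) (F : gT -> M) :
  linear (fun f : V => \sum_g (f g : A) *: F g).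
Proof.
move=> a u v; rewrite scaler_sumr -big_split /=.
by apply: eq_bigr => g _; rewrite !ffunE scalerDl scalerA.
Qed.

Lemma ga_linear_ext (M : lmodType A) (F G : V -> M) :
  linear F -> linear G -> (forall g, F (e_ g) = G (e_ g)) -> F =1 G.
Proof.
move=> Fl Gl FG.
have lin0 (H : V -> M) : linear H -> H 0 = 0.
  by move=> Hl; have := Hl (-1) 0 0; rewrite scaler0 addr0 scaleN1r addNr.
move=> f; rewrite (ga_decomp f).
have linS (H : V -> M) : linear H ->
    H (\sum_g (f g : A) *: e_ g) = \sum_g (f g : A) *: H (e_ g).
  move=> Hl; apply: (big_rec2 (fun x y => H x = y)); first exact: lin0.
  by move=> g x y _ <-; rewrite Hl.
by rewrite !linS //; apply: eq_bigr => g _; rewrite FG.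
Qed.

Lemma ga_comul_linear : linear ga_comul.
Proof. exact: ga_sum_linear. Qed.

Lemma ga_counit_linear : scalar ga_counit.
Proof.
move=> a u v; rewrite /ga_counit mulr_sumr -big_split /=.
by apply: eq_bigr => g _; rewrite !ffunE.
Qed.

Lemma ga_comul_basis g : ga_comul (e_ g) = e_ g ⊗ e_ g.
Proof. exact: ga_sumE. Qed.

Lemma ga_counit_basis g : ga_counit (e_ g) = 1.
Proof.
rewrite /ga_counit (bigD1 g) //= big1 => [|h hg]; rewrite ffunE.
  by rewrite eqxx addr0.
by rewrite (negPf hg).
Qed.

Lemma ga_mul_in_balanced :
  balanced (fun f f' : V => \sum_g \sum_h (f g * f' h : A) *: e_ (g * h)%g).
Proof.
split=> [f|f f' f''|f f' f''|a f f'].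
- by rewrite !big1 // => g _; rewrite big1 // => h _; rewrite ffunE mul0r scale0r.
- rewrite -big_split /=; apply: eq_bigr => g _; rewrite -big_split /=.
  by apply: eq_bigr => h _; rewrite ffunE mulrDl scalerDl.
- rewrite -big_split /=; apply: eq_bigr => g _; rewrite -big_split /=.
  by apply: eq_bigr => h _; rewrite ffunE mulrDr scalerDl.
apply: eq_bigr => g _; apply: eq_bigr => h _; rewrite !ffunE.
by rewrite [a *: f g]mulrC [a *: f' h]/(a * f' h) mulrA.
Qed.

Lemma ga_mul_linear : linear ga_mul.
Proof.
apply: tlift_linear; first exact: ga_mul_in_balanced.
move=> a f f'; rewrite scaler_sumr; apply: eq_bigr => g _.
rewrite scaler_sumr; apply: eq_bigr => h _.
by rewrite ffunE scalerA [a *: f g]/(a * f g) mulrA.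
Qed.

Lemma ga_mul_basis g h : ga_mul (e_ g ⊗ e_ h) = e_ (g * h)%g.
Proof.
rewrite /ga_mul tlift_tens; last exact: ga_mul_in_balanced.
rewrite -[RHS](ga_sumE (fun g => e_ (g * h)%g)); apply: eq_bigr => g' _.
rewrite -[e_ (g' * h)%g](ga_sumE (fun h => e_ (g' * h)%g)) scaler_sumr.
by apply: eq_bigr => h' _; rewrite scalerA.
Qed.

Lemma ga_unit_linear : linear (ga_unit : A^o -> V).
Proof. by move=> a u v; rewrite /ga_unit scalerDl scalerA. Qed.

Lemma ga_antipode_linear : linear ga_antipode.
Proof. exact: ga_sum_linear. Qed.

Lemma ga_antipode_basis g : ga_antipode (e_ g) = e_ g^-1%g.
Proof. exact: ga_sumE. Qed.

Lemma ga_tensor_ext (M : lmodType A) (F G : tensor V V -> M) :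
  linear F -> linear G ->
  (forall g h, F (e_ g ⊗ e_ h) = G (e_ g ⊗ e_ h)) -> F =1 G.
Proof.
move=> Fl Gl FG; case: (linear_parts Fl) (linear_parts Gl).
move=> F0 FD FZ [G0 GD GZ]; elim/tens_ind => [|x y IH IH'|d e].
- by rewrite F0 G0.
- by rewrite FD GD IH IH'.
case: (tens_balanced V V) => t0 tl tr tz.
apply: (ga_linear_ext (F := fun d => F (d ⊗ e)) (G := fun d => G (d ⊗ e))).
- by apply: linear_comp => // a u v; rewrite tl tensZl.
- by apply: linear_comp => // a u v; rewrite tl tensZl.
move=> g.
apply: (ga_linear_ext (F := fun e => F (e_ g ⊗ e)) (G := fun e => G (e_ g ⊗ e))).
- by apply: linear_comp => // a u v; rewrite tr tensZr.
- by apply: linear_comp => // a u v; rewrite tr tensZr.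
by move=> h; exact: FG.
Qed.

Lemma cap_balanced (x : V -> A) : scalar x ->
  balanced (fun d1 d2 : V => x d2 *: d1).
Proof.
move=> xl.
have x0 : x 0 = 0 by have := xl (-1) 0 0; rewrite scaler0 addr0 mulN1r addNr.
have xZ a d : x (a *: d) = a * x d by rewrite -[a *: d]addr0 xl x0 addr0.
have xD d e : x (d + e) = x d + x e by rewrite -[d]scale1r xl !scale1r mul1r.
split=> [e|d d' e|d e e'|a d e].
- by rewrite scaler0.
- by rewrite scalerDr.
- by rewrite xD scalerDl.
- by rewrite xZ scalerA mulrC.
Qed.

Lemma ga_is_coalgebra : is_coalgebra ga_coalgebra.
Proof.
have cl := ga_comul_linear.
have idl := @id_linear A V.
split; first exact: ga_comul_linear.
- exact: ga_counit_linear.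
- apply: (@ga_linear_ext _ (fun d => tassoc (tmap ga_comul id (ga_comul d)))
    (fun d => tmap id ga_comul (ga_comul d))) => [||g].
  + apply: linear_comp; first exact: tassoc_linear.
    by apply: linear_comp => //; exact: tmap_linear.
  + by apply: linear_comp => //; exact: tmap_linear.
  by rewrite ga_comul_basis !tmap_tens // ga_comul_basis tassoc_tens.
- apply: (@ga_linear_ext _ (fun d => tswap (ga_comul d)) ga_comul) => // [|g].
    apply: linear_comp => //; apply: tlift_linear; first exact: tswap_balanced.
    by move=> a d e; rewrite tensZr.
  by rewrite ga_comul_basis /tswap tlift_tens //; exact: tswap_balanced.
apply: (@ga_linear_ext _ (cap (C := ga_coalgebra) ga_counit) id) => // [|g].
  apply: (@linear_comp _ _ _ _ (tlift _) ga_comul) => //.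
  apply: tlift_linear; first exact: cap_balanced ga_counit_linear.
  by move=> a d e; rewrite !scalerA mulrC.
rewrite /cap /= ga_comul_basis tlift_tens; last exact: cap_balanced ga_counit_linear.
by rewrite ga_counit_basis scale1r.
Qed.

Lemma ga_mul_map :
  @is_coalgebra_map A (tensor_coalgebra ga_coalgebra ga_coalgebra)
    ga_coalgebra ga_mul.
Proof.
have ml := ga_mul_linear.
split=> //=.
- apply: ga_tensor_ext => [||g h].
  + by apply: linear_comp => //; exact: ga_comul_linear.
  + apply: linear_comp; first exact: tmap_linear.
    exact: (tensor_comul_linear (C := ga_coalgebra) (C' := ga_coalgebra)
      ga_comul_linear ga_comul_linear).
  rewrite ga_mul_basis ga_comul_basis.
  have := tensor_comul_tens (C := ga_coalgebra) (C' := ga_coalgebra)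
      ga_comul_linear ga_comul_linear (ga_comul_basis g) (ga_comul_basis h).
  by move=> /= ->; rewrite tmap_tens // ga_mul_basis.
have Bb : balanced (fun c c' : V => ga_counit c * ga_counit c' : A^o).
  apply: bilinear_balanced => c a u v; rewrite ga_counit_linear.
    by rewrite mulrDl -mulrA.
  by rewrite mulrDr mulrCA.
apply: (@ga_tensor_ext A^o (fun d => ga_counit (ga_mul d))) => [||g h].
- by apply: (@linear_comp A _ V A^o ga_counit) => //; exact: ga_counit_linear.
- apply: tlift_linear => // a d e.
  by case: (linear_parts (ga_counit_linear : linear (ga_counit : V -> A^o)))
    => _ _ ->; rewrite -[LHS]mulrA.
by rewrite ga_mul_basis tlift_tens // !ga_counit_basis mulr1.
Qed.

Lemma ga_unit_map : @is_coalgebra_map A (unit_coalgebra A) ga_coalgebra ga_unit.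
Proof.
split=> [|a|a] /=; first exact: ga_unit_linear.
  rewrite tmap_tens; try exact: ga_unit_linear.
  rewrite {1}/ga_unit; case: (linear_parts ga_comul_linear) => _ _ ->.
  by rewrite ga_comul_basis -tensZl /ga_unit scale1r.
rewrite /ga_unit.
case: (linear_parts (ga_counit_linear : linear (ga_counit : V -> A^o))) => _ _ ->.
by rewrite ga_counit_basis; exact: mulr1.
Qed.

Lemma ga_antipode_map : @is_coalgebra_map A ga_coalgebra ga_coalgebra ga_antipode.
Proof.
have al := ga_antipode_linear.
split=> //=.
- apply: ga_linear_ext => [||g].
  + by apply: linear_comp => //; exact: ga_comul_linear.
  + by apply: linear_comp; [exact: tmap_linear | exact: ga_comul_linear].
  by rewrite ga_antipode_basis !ga_comul_basis tmap_tens // ga_antipode_basis.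
apply: (@ga_linear_ext A^o (fun d => ga_counit (ga_antipode d))) => [||g].
- by apply: (@linear_comp A _ V A^o ga_counit) => //; exact: ga_counit_linear.
- exact: ga_counit_linear.
by rewrite ga_antipode_basis !ga_counit_basis.
Qed.

Lemma ga_mulA (t : tensor (tensor V V) V) :
  ga_mul (tmap ga_mul id t) = ga_mul (tmap id ga_mul (tassoc t)).
Proof.
have ml := ga_mul_linear; have idl := @id_linear A V.
have Ll : linear (fun t => ga_mul (tmap ga_mul id t)).
  by apply: linear_comp => //; exact: tmap_linear.
have Rl : linear (fun t : tensor (tensor V V) V =>
    ga_mul (tmap id ga_mul (tassoc t))).
  apply: linear_comp => //; apply: linear_comp; first exact: tmap_linear.
  exact: tassoc_linear.
case: (linear_parts Ll) (linear_parts Rl) => L0 LD _ [R0 RD _].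
elim/tens_ind: t => [|x y IH IH'|s k].
- by rewrite L0 R0.
- by rewrite LD RD IH IH'.
move: s; apply: ga_tensor_ext => [||g h].
- exact: linear_comp Ll (tens_linearl k).
- exact: linear_comp Rl (tens_linearl k).
move: k; apply: ga_linear_ext => [||k].
- exact: linear_comp Ll (tens_linearr _).
- exact: linear_comp Rl (tens_linearr _).
by rewrite tassoc_tens !tmap_tens // !ga_mul_basis mulgA.
Qed.

Lemma ga_mul1l a d : ga_mul (ga_unit a ⊗ d) = a *: d.
Proof.
have ml := ga_mul_linear.
rewrite /ga_unit tensZl; case: (linear_parts ml) => _ _ ->; congr (_ *: _).
move: d; apply: ga_linear_ext => [||g] //.
  exact: linear_comp ml (tens_linearr _).
by rewrite ga_mul_basis mul1g.
Qed.

Lemma ga_mul1r d a : ga_mul (d ⊗ ga_unit a) = a *: d.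
Proof.
have ml := ga_mul_linear.
rewrite /ga_unit tensZr; case: (linear_parts ml) => _ _ ->; congr (_ *: _).
move: d; apply: ga_linear_ext => [||g] //.
  exact: linear_comp ml (tens_linearl _).
by rewrite ga_mul_basis mulg1.
Qed.

Lemma ga_unit_counit_linear : linear (fun d => ga_unit (ga_counit d)).
Proof.
apply: (@linear_comp A V A^o V ga_unit); first exact: ga_unit_linear.
exact: ga_counit_linear.
Qed.

Lemma ga_mulVl d :
  ga_mul (tmap ga_antipode id (ga_comul d)) = ga_unit (ga_counit d).
Proof.
have ml := ga_mul_linear; have al := ga_antipode_linear.
have idl := @id_linear A V.
move: d; apply: ga_linear_ext => [||g].
- apply: linear_comp => //.
  by apply: linear_comp; [exact: tmap_linear | exact: ga_comul_linear].
- exact: ga_unit_counit_linear.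
rewrite ga_comul_basis tmap_tens // ga_antipode_basis ga_mul_basis mulVg.
by rewrite ga_counit_basis /ga_unit scale1r.
Qed.

Lemma ga_mulVr d :
  ga_mul (tmap id ga_antipode (ga_comul d)) = ga_unit (ga_counit d).
Proof.
have ml := ga_mul_linear; have al := ga_antipode_linear.
have idl := @id_linear A V.
move: d; apply: ga_linear_ext => [||g].
- apply: linear_comp => //.
  by apply: linear_comp; [exact: tmap_linear | exact: ga_comul_linear].
- exact: ga_unit_counit_linear.
rewrite ga_comul_basis tmap_tens // ga_antipode_basis ga_mul_basis mulgV.
by rewrite ga_counit_basis /ga_unit scale1r.
Qed.

Definition group_algebra : hopfAlgebra A :=
  @HopfAlgebra A ga_coalgebra ga_mul ga_unit ga_antipode ga_is_coalgebra
    ga_mul_map ga_unit_map ga_antipode_map ga_mulA ga_mul1l ga_mul1r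
    ga_mulVl ga_mulVr.

End GroupAlgebra.

(* The character group {1, σ}: its product, written _ * _ in group_scope, is  *)
(* the addition of Z/2, so that 1 is 1%g = 0 and σ is the class of 1.         *)
Definition C2dual : finGroupType := 'Z_2.
Definition sigma : C2dual := Zp1.

Section Coordinate.
Variables (A : comPzRingType) (D : hopfAlgebra A).
Variable ch : group_algebra A C2dual -> D.
Implicit Type x : D -> A.

Definition character (r : C2dual) : D := ch (ga_basis A r).

Definition twist x : D -> A := fun d => x (hopf_mul (character sigma ⊗ d)).

(* ⟨d, functional_pow x m n⟩ = ⟨d, x^{m + n σ}⟩; for m = n = 0 it is the      *)
(* counit, i.e. the empty iterated coproduct.                                 *)
Definition functional_pow x (m n : nat) : D -> A :=
  iter m (conv x) (iter n (conv (twist x)) counit).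

End Coordinate.

Record efgl := EFGL {
  base : comPzRingType;
  hopf : hopfAlgebra base;
  chars : group_algebra base C2dual -> hopf;
  coord : {scalar hopf};
  chars_hopf_map : is_hopf_map idfun chars;
  unit_injective : injective (@hopf_unit base hopf);
  unit_exact : forall d : hopf,
    cap coord d = 0 <-> exists a, d = hopf_unit a;
  cap_surjective : forall d : hopf, exists d', cap coord d' = d;
  cap_nilpotent : forall d : hopf, exists m n,
    cap (functional_pow chars coord m n) d = 0 }.

Definition efgl_char (E : efgl) (r : C2dual) : hopf E := character (@chars E) r.

Record efgl_map (E E' : efgl) := EFGLMap {
  base_map : {rmorphism base E -> base E'};
  hopf_map : hopf E -> hopf E';
  hopf_mapP : is_hopf_map base_map hopf_map;
  hopf_map_char : forall r, hopf_map (efgl_char E r) = efgl_char E' r;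
  hopf_map_coord : forall d,
    coord E' (hopf_map d) = base_map (coord E d) }.

Record universal_efgl := UniversalEFGL {
  universal_law :> efgl;
  canonical_map : forall E : efgl, efgl_map universal_law E;
  canonical_map_unique : forall (E : efgl) (f : efgl_map universal_law E),
    base_map f =1 base_map (canonical_map E) /\
    hopf_map f =1 hopf_map (canonical_map E) }.

(* For the universal law this is the Euler class of C^σ: x is the Euler class *)
(* of the canonical line bundle on CP(U), which restricts to C^σ at σ.        *)
Definition euler_class (E : efgl) : base E := coord E (efgl_char E sigma).

(* Flags are indexed from 0: rho i is the term usually written rho_{i+1}.     *)
Definition complete_flag (rho : nat -> C2dual) : Prop :=
  forall (r : C2dual) (N : nat), exists2 i, (N <= i)%N & rho i = r.

(* The representation rho_0 + ... + rho_i is m + n σ with m, n as follows.    *)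
Definition flag_mult (rho : nat -> C2dual) (r : C2dual) (i : nat) : nat :=
  \sum_(j < i.+1) (rho j == r).

Definition flag_class (T : Type) (P : nat -> nat -> T) (rho : nat -> C2dual)
    (i : nat) : T :=
  P (flag_mult rho 1%g i) (flag_mult rho sigma i).

(* The multiplicity of σ in (rho_0 + ... + rho_(i-1)) rho_i^-1.               *)
Definition flag_shift (rho : nat -> C2dual) (i : nat) : nat :=
  \sum_(j < i) ((rho j * (rho i)^-1)%g == sigma).

Definition is_basis (A : comPzRingType) (M : lmodType A) (b : nat -> M) : Prop :=
  (forall y, exists N (a : nat -> A), y = \sum_(i < N) a i *: b i) /\
  (forall N (a : nat -> A), \sum_(i < N) a i *: b i = 0 ->
     forall i, (i < N)%N -> a i = 0).

(* The part of C_2-equivariant complex cobordism that enters filtered formal  *)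
(* group laws: the universal law (MU^{C_2}_*, MU^{C_2}_*(CP(U))), the ring    *)
(* Ω^{C_2}_* with the Pontrjagin-Thom map, and the classes Π_{m + n σ} of     *)
(* CP(C^m ⊕ (C^σ)^n) -> CP(U), with their basis property. The universal law   *)
(* is determined up to isomorphism; the geometric origin of Omega,            *)
(* pontrjagin_thom and proj_class is not recorded, so that what is proved     *)
(* about a complex_cobordism holds for every choice of these data, the        *)
(* geometric one among them.                                                  *)
Record complex_cobordism := ComplexCobordism {
  MU :> universal_efgl;
  Omega : pzRingType;
  pontrjagin_thom : {rmorphism Omega -> base MU};
  proj_class : nat -> nat -> hopf MU;
  proj_class_basis : forall (E : efgl) (rho : nat -> C2dual),
    complete_flag rho ->
    is_basis (fun i =>
      hopf_map (canonical_map MU E) (flag_class proj_class rho i)) }.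

Definition is_subgroup (M : zmodType) (H : set M) : Prop :=
  H 0 /\ forall y z, H y -> H z -> H (y - z).

Definition additive_span (M : zmodType) (G : set M) : set M :=
  smallest (@is_subgroup M) G.

(* The S-submodule of A generated by G, for S a subset of A.                  *)
Definition submodule_span (A : comPzRingType) (S G : set A) : set A :=
  smallest (fun H => is_subgroup H /\ forall s h, S s -> H h -> H (s * h)) G.

Section Cobordism.
Variable C : complex_cobordism.

Definition FMU (n : nat) : set (base C) :=
  submodule_span (range (pontrjagin_thom C))
    [set euler_class C ^+ k | k in [set k | (k <= n)%N]].

Section Images.
Variable E : efgl.

Definition to_base : base C -> base E := base_map (canonical_map C E).

Definition base_u : base E := to_base (euler_class C).

Definition hopf_Pi (m n : nat) : hopf E :=
  hopf_map (canonical_map C E) (proj_class C m n).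

End Images.

Record filtered_efgl := FilteredEFGL {
  filtered_law :> efgl;
  FA : nat -> set (base filtered_law);
  FD : nat -> set (hopf filtered_law);
  FA_subgroup : forall n, is_subgroup (FA n);
  FD_subgroup : forall n, is_subgroup (FD n);
  FA_increasing : forall n, FA n `<=` FA n.+1;
  FD_increasing : forall n, FD n `<=` FD n.+1;
  FA_Omega : range (@to_base filtered_law \o pontrjagin_thom C) `<=` FA 0;
  (* For n = 0 this makes FA 0 a subring. *)
  FA_generated : forall n, FA n =
    submodule_span (FA 0)
      [set base_u filtered_law ^+ k | k in [set k | (k <= n)%N]];
  FD_flag : forall (rho : nat -> C2dual), complete_flag rho -> forall n,
    FD n = [set d | exists N (a : nat -> base filtered_law),
      (forall i, (i < N)%N -> FA (n + flag_shift rho i)%N (a i)) /\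
      d = \sum_(i < N) a i *: flag_class (hopf_Pi filtered_law) rho i] }.

End Cobordism.

Arguments FA {C} f n _.
Arguments FD {C} f n _.
Arguments FMU C n _ : clear implicits.
Arguments to_base C E _ : clear implicits.
Arguments base_u C E : clear implicits.
Arguments hopf_Pi C E m n : clear implicits.

(* Main.v *)
Require Import Defs.
From mathcomp Require Import all_fingroup.
From mathcomp Require Import all_boot all_order all_algebra.
From mathcomp Require Import boolp classical_sets.

Import GRing.Theory.

Local Open Scope classical_set_scope.
Local Open Scope ring_scope.

(** Since [F_(n+m) A] is spanned over [F_0 A] by [u^k] with [k <= n + m], and
    each such [u^k] splits as [u^i * u^j] with [i <= n] and [j <= m], one has
    [F_(n+m) A = F_n MU * F_m A]. The case [m = 0] is the first claim. For the
    second, fix a complete flag and apply this to every coefficient [a_i] of an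
    element of [F_n D], which lies in [F_(n + l_i) A]: the factor in
    [F_(l_i) A] times the [i]-th basis element lies in [F_0 D]. *)

Lemma subgroupD (M : zmodType) (H : set M) x y :
  is_subgroup H -> H x -> H y -> H (x + y).
Proof.
move=> [H0 HB] Hx Hy; rewrite -[y]opprK; apply: (HB) => //.
by rewrite -sub0r; apply: HB.
Qed.

Lemma subgroup_sum (M : zmodType) (H : set M) (N : nat) (f : nat -> M) :
  is_subgroup H -> (forall i, (i < N)%N -> H (f i)) -> H (\sum_(i < N) f i).
Proof.
move=> sH Hf; apply: (@big_ind _ H); first by case: sH.
  by move=> x y; exact: subgroupD.
by move=> i _; exact: Hf.
Qed.

(** Supports induction over spans: to show that [f] sends a whole span into [H], it is enough that
    this preimage is a subgroup containing the generators. *)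
Lemma subgroup_preimage (M M' : zmodType) (f : M -> M') (H : set M') :
  (forall x y, f (x - y) = f x - f y) -> is_subgroup H ->
  is_subgroup (f @^-1` H).
Proof.
move=> fB [H0 HB]; split=> [|x y /= Hx Hy]; last by rewrite fB; exact: HB.
by rewrite /= -(subr0 0) fB subrr.
Qed.

Section AdditiveSpan.
Variables (M : zmodType) (G : set M).

Lemma additive_span_subgroup : is_subgroup (additive_span G).
Proof.
split=> [H [[]] //|y z Gy Gz H HG].
by case: (HG) => -[_ HB] _; apply: HB; [exact: Gy | exact: Gz].
Qed.

Lemma sub_additive_span : G `<=` additive_span G.
Proof. by move=> x Gx H [_]; exact. Qed.

Lemma additive_span_sub (H : set M) :
  is_subgroup H -> G `<=` H -> additive_span G `<=` H.
Proof. by move=> sH GH x; apply. Qed.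

End AdditiveSpan.

Lemma additive_span_image (M M' : zmodType) (f : M -> M') (G : set M)
    (G' : set M') :
  (forall x y, f (x - y) = f x - f y) ->
  (forall x, G x -> additive_span G' (f x)) ->
  forall x, additive_span G x -> additive_span G' (f x).
Proof.
move=> fB fG x; apply: (@additive_span_sub _ _ (f @^-1` additive_span G')) => //.
by apply: subgroup_preimage fB _; exact: additive_span_subgroup.
Qed.

Section SubmoduleSpan.
Variables (A : comPzRingType) (S G : set A).

Lemma submodule_span_subgroup : is_subgroup (submodule_span S G).
Proof.
split=> [H [[[]]] //|y z Gy Gz H HG].
by case: (HG) => -[[_ HB] _] _; apply: HB; [exact: Gy | exact: Gz].
Qed.

Lemma submodule_spanM s h :
  S s -> submodule_span S G h -> submodule_span S G (s * h).
Proof. by move=> Ss Gh H HG; case: (HG) => -[_ HM] _; apply: HM => //; exact: Gh. Qed.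

Lemma sub_submodule_span : G `<=` submodule_span S G.
Proof. by move=> x Gx H [_]; exact. Qed.

Lemma submodule_span_sub (H : set A) :
  is_subgroup H -> (forall s h, S s -> H h -> H (s * h)) ->
  G `<=` H -> submodule_span S G `<=` H.
Proof. by move=> sH HM GH x; apply. Qed.

End SubmoduleSpan.

(** One concrete complete flag: [FD_flag] describes [FD] only relative to a flag. *)
Definition alternating_flag (i : nat) : C2dual := if odd i then sigma else 1%g.

Lemma alternating_flag_complete : complete_flag alternating_flag.
Proof.
move=> r N.
have rE : r = if r == 1%g then 1%g else sigma.
  by case: r => -[|[|[]]] // ? /=; apply/val_inj.
(* An index beyond [N] whose parity selects [r]: even for the trivial character, odd for [sigma]. *)
exists (N.*2 + (r != 1%g))%N; first by rewrite -addnn -addnA leq_addr.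
by rewrite {2}rE /alternating_flag oddD odd_double; case: (r == 1%g).
Qed.

Section Filtered.
Variables (C : complex_cobordism) (F : filtered_efgl C).
Local Notation u := (base_u C F).

Lemma FA_base_mul n s a : FA F 0 s -> FA F n a -> FA F n (s * a).
Proof. by rewrite (FA_generated F n); exact: submodule_spanM. Qed.

Lemma FA_exp n k : (k <= n)%N -> FA F n (u ^+ k).
Proof.
by move=> kn; rewrite FA_generated; apply: sub_submodule_span; exists k.
Qed.

(** Span induction on [a], then on [b], leaves only the products of generators [u ^+ k * u ^+ j],
    where exponents add. *)
Lemma FA_mul n m a b : FA F n a -> FA F m b -> FA F (n + m) (a * b).
Proof.
move=> Fa Fb; move: a Fa; rewrite (FA_generated F n).
apply: (@submodule_span_sub _ _ _ ( *%R^~ b @^-1` FA F (n + m))).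
- by apply: subgroup_preimage (FA_subgroup _ _) => x y; rewrite mulrBl.
- by move=> s h Fs /= Fh; rewrite -mulrA; exact: FA_base_mul.
move=> _ /= [k kn <-]; move: b Fb; rewrite (FA_generated F m).
apply: (@submodule_span_sub _ _ _ ( *%R (u ^+ k) @^-1` FA F (n + m))).
- by apply: subgroup_preimage (FA_subgroup _ _) => x y; rewrite mulrBr.
- by move=> s h Fs /= Fh; rewrite mulrCA; exact: FA_base_mul.
by move=> _ /= [j jm <-]; rewrite -exprD; apply: FA_exp; exact: leq_add.
Qed.

(** The canonical map carries the scalars from [Omega] into [FA F 0] and powers of the Euler class
    to powers of [u]. *)
Lemma to_base_FMU n m : FMU C n m -> FA F n (to_base C F m).
Proof.
apply: (@submodule_span_sub _ _ _ (to_base C F @^-1` FA F n)).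
- by apply: subgroup_preimage (FA_subgroup _ _) => x y; rewrite /to_base rmorphB.
- move=> _ h [w _ <-] /= Fh; rewrite /to_base rmorphM.
  by apply: FA_base_mul => //; apply: FA_Omega; exists w.
- by move=> _ /= [k kn <-]; rewrite /to_base rmorphXn; exact: FA_exp.
Qed.

Lemma FA_split n m : FA F (n + m) `<=`
  additive_span [set to_base C F x * a | x in FMU C n & a in FA F m].
Proof.
rewrite FA_generated; apply: submodule_span_sub.
- exact: additive_span_subgroup.
(* A scalar from [FA F 0] is absorbed into the right factor, which stays in [FA F m]. *)
- move=> s h Fs; move: h; apply: additive_span_image => [x y|_ [x Mx [a Fa <-]]].
    by rewrite mulrBr.
  apply: sub_additive_span; exists x => //; exists (s * a); last by rewrite mulrCA.
  exact: FA_base_mul.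
move=> _ /= [k knm <-]; apply: sub_additive_span.
(* The left factor takes as many powers of the Euler class as level [n] allows; the truncated
   difference [k - n] remains, at most [m]. *)
exists (euler_class C ^+ minn k n).
  by apply: sub_submodule_span; exists (minn k n) => //=; exact: geq_minr.
exists (u ^+ (k - n)); first by apply: FA_exp; rewrite leq_subLR.
by rewrite /to_base rmorphXn -exprD minnE subnK // leq_subr.
Qed.

(** Multiplying by [a] raises the level of each flag coefficient by [n], from [flag_shift] to
    [n + flag_shift]. *)
Lemma FD_scale n a d : FA F n a -> FD F 0 d -> FD F n (a *: d).
Proof.
move=> Fa; rewrite !(FD_flag _ alternating_flag_complete).
move=> [N [b [Fb ->]]]; exists N, (fun i => a * b i); split=> [i iN|].
  by apply: FA_mul => //; exact: Fb.
by rewrite scaler_sumr; apply: eq_bigr => i _; rewrite scalerA.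
Qed.

Lemma FD_split n : FD F n `<=`
  additive_span [set to_base C F m *: d | m in FMU C n & d in FD F 0].
Proof.
set rho := alternating_flag; have rhoP := alternating_flag_complete.
rewrite {1}(FD_flag _ rhoP) => _ [N [a [Fa ->]]].
pose b i := flag_class (hopf_Pi C F) rho i.
apply: (@subgroup_sum _ _ _ (fun i => a i *: b i)) => [|i iN].
  exact: additive_span_subgroup.
(* Here the second level in [FA_split] is [flag_shift rho i], exactly the level that [FD F 0] allows
   for the [i]-th coefficient. *)
move: (FA_split _ _ _ (Fa i iN)); move: (a i).
apply: (@additive_span_image _ _ (fun c => c *: b i)) => [x y|_ [m Mm [c Fc <-]]].
  by rewrite scalerBl.
apply: sub_additive_span; exists m => //; exists (c *: b i); last by rewrite scalerA.
(* The single term [c *: b i] is read as a combination of length [i.+1], so that index [i] is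
   included, with all earlier coefficients zero. *)
rewrite (FD_flag _ rhoP); exists i.+1, (fun j => if j == i then c else 0).
split=> [j _|].
  by case: eqP => [->//|_]; case: (FA_subgroup F (0 + flag_shift rho j)).
rewrite big_ord_recr /= eqxx big1 ?add0r // => j _.
by rewrite ltn_eqF // scale0r.
Qed.

End Filtered.

Theorem theorem3p10 (C : complex_cobordism) (F : filtered_efgl C) (n : nat) :
  FA F n = additive_span [set to_base C F m * a | m in FMU C n & a in FA F 0] /\
  FD F n = additive_span [set to_base C F m *: d | m in FMU C n & d in FD F 0].
Proof.
split; apply/seteqP; split.
- by rewrite -{1}[n]addn0; exact: FA_split.
- apply: additive_span_sub; first exact: FA_subgroup.
  move=> _ [m Mm [a Fa <-]]; rewrite -[n]addn0.
  by apply: FA_mul => //; exact: to_base_FMU.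
- exact: FD_split.
apply: additive_span_sub; first exact: FD_subgroup.
move=> _ [m Mm [d Fd <-]]; apply: FD_scale => //; exact: to_base_FMU.
Qed.
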